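(* Consider a Stackelberg network pricing game with multiple weighted followers as described in the context, and let $r^*$ be the maximum revenue achievable by the leader. For any $\varepsilon>0$, the single-price algorithm computes a price function whose revenue $r$ satisfies $(1+\varepsilon)m^2\cdot r\ge r^*$.
   Context: A Stackelberg network pricing game (edge game): multigraph $G=(V,E)$, $E=E_p\cup E_f$ disjoint; fixed costs $c(e)\ge 0$ for $e\in E_f$; leader chooses prices $p(e)\ge 0$ for $e\in E_p$; $m=|E_p|$. Followers $j=1,\dots,k$ each have a collection $\mathcal{S}_j\subseteq 2^E$ of feasible subnetworks, at least one of which contains only fixed-price edges, and a demand $d_j\ge 0$. The weight of $S$ is $w(S)=\sum_{e\in S\cap E_f}c(e)+\sum_{e\in S\cap E_p}p(e)$. Each follower $j$ chooses a minimum-weight $S_j\in\mathcal{S}_j$ (computable in polynomial time for any prices), breaking ties in favor of higher revenue for the leader. The leader's revenue is $\sum_{j=1}^k d_j\sum_{e\in S_j\cap E_p}p(e)$. The single-price algorithm tries, for $j=0,1,2,\dots$ up to a logarithmic bound determined by the fixed costs, the assignment of the same price $(1+\varepsilon)^j$ to all priceable edges, and returns the one with maximum revenue.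
   Formalization: The formal theorem adds that the monetary unit is such that any follower who buys priceable edges at some positive common price also buys at common price 1; without this the claim fails, since the smallest price tried is 1 and the algorithm may earn 0 while r*>0. *)

(* Defs.v *)
From HB Require Import structures.
From mathcomp Require Import all_boot all_order all_algebra.
From mathcomp Require Import reals exp.

Set Implicit Arguments.
Unset Strict Implicit.
Unset Printing Implicit Defensive.

Import Order.TTheory GRing.Theory Num.Theory.
Local Open Scope ring_scope.

(* [cost e] is meaningful only for [e \notin priceable]. Parallel edges and
   loops are allowed; the orientation given by [ends] plays no role. *)
Record pricing_game (R : realType) := PricingGame {
  vertex : finType;
  edge : finType;
  ends : edge -> vertex * vertex;
  priceable : {set edge};
  cost : edge -> R;
  cost_ge0 : forall e, e \notin priceable -> 0 <= cost e;
  followers : nat;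
  feasible : 'I_followers -> {set {set edge}};
  feasible_fixed : forall j,
    exists S, (S \in feasible j) && (S \subset ~: priceable);
  demand : 'I_followers -> R;
  demand_ge0 : forall j, 0 <= demand j }.

(* Only the values of a price function on [priceable G] matter. *)
Definition prices (R : realType) (G : pricing_game R) := edge G -> R.

Definition admissible (R : realType) (G : pricing_game R) (p : prices G) :=
  forall e, e \in priceable G -> 0 <= p e.

Definition fixed_cost (R : realType) (G : pricing_game R)
    (S : {set edge G}) : R :=
  \sum_(e in S :&: ~: priceable G) cost e.

Definition payment (R : realType) (G : pricing_game R) (p : prices G)
    (S : {set edge G}) : R :=
  \sum_(e in S :&: priceable G) p e.

Definition weight (R : realType) (G : pricing_game R) (p : prices G)
    (S : {set edge G}) : R :=
  fixed_cost S + payment p S.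

Definition min_weight (R : realType) (G : pricing_game R) (p : prices G)
    (j : 'I_(followers G)) (S : {set edge G}) : bool :=
  (S \in feasible j) && [forall T in feasible j, weight p S <= weight p T].

Definition best_response (R : realType) (G : pricing_game R) (p : prices G)
    (j : 'I_(followers G)) (S : {set edge G}) : bool :=
  min_weight p j S &&
  [forall T, min_weight p j T ==> (payment p T <= payment p S)].

(* By [response_best] the default value [set0] is never used. All best
   responses of a follower give the same payment, so which one is picked has
   no effect on the revenue. *)
Definition response (R : realType) (G : pricing_game R) (p : prices G)
    (j : 'I_(followers G)) : {set edge G} :=
  odflt set0 [pick S | best_response p j S].

Definition revenue (R : realType) (G : pricing_game R) (p : prices G) : R :=
  \sum_(j < followers G) demand j * payment p (response p j).

Definition is_max_revenue (R : realType) (G : pricing_game R) (r : R) : Prop :=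
  (exists2 p : prices G, admissible p & revenue p = r) /\
  (forall p : prices G, admissible p -> revenue p <= r).

Definition uniform (R : realType) (G : pricing_game R) (q : R) : prices G :=
  fun=> q.
Arguments uniform {R} G q _.

Definition fixed_only_cost (R : realType) (G : pricing_game R)
    (j : 'I_(followers G)) : R :=
  fixed_cost [arg min_(S < xchoose (feasible_fixed j) |
      (S \in feasible j) && (S \subset ~: priceable G)) fixed_cost S]%O.

Definition max_fixed_only_cost (R : realType) (G : pricing_game R) : R :=
  \big[Num.max/0]_(j < followers G) fixed_only_cost j.

(* floor (log_(1+eps) c) for the largest fixed-only cost c, and 0 if c < 1
   ([Num.truncn] is 0 on negative numbers and [ln 0 = 0]). *)
Definition last_exponent (R : realType) (G : pricing_game R) (eps : R) : nat :=
  Num.truncn (ln (max_fixed_only_cost G) / ln (1 + eps)).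

Definition single_price (R : realType) (G : pricing_game R) (eps : R) :
    prices G :=
  uniform G ((1 + eps) ^+
    [arg max_(i > (ord0 : 'I_(last_exponent G eps).+1))
       revenue (uniform G ((1 + eps) ^+ i))]%O).
Arguments single_price {R} G eps _.

Definition buys (R : realType) (G : pricing_game R) (p : prices G)
    (j : 'I_(followers G)) : bool :=
  response p j :&: priceable G != set0.

(* The smallest price tried by the algorithm is 1, so the algorithm presupposes
   a monetary unit in which 1 is not already prohibitive: a follower who buys
   at some positive common price buys at the common price 1. Multiplying all
   costs by a large enough constant achieves this and only rescales revenues.
   Without it the approximation guarantee fails: if the only alternatives are
   one fixed-price edge of cost 1 and a path of two priceable edges, every
   price tried has revenue 0, but the maximum revenue is 1. *)
Definition unit_normalized (R : realType) (G : pricing_game R) : Prop :=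
  forall (j : 'I_(followers G)) (q : R), 0 < q ->
    buys (uniform G q) j -> buys (uniform G 1) j.

Lemma response_best (R : realType) (G : pricing_game R) (p : prices G)
    (j : 'I_(followers G)) : best_response p j (response p j).
Proof.
rewrite /response; case: pickP => //= noBR; exfalso.
have [S0 /andP[S0f _]] := feasible_fixed j.
have [S1 S1f S1min] := arg_minP (P := mem (feasible j)) (weight p) S0f.
have S1w : min_weight p j S1.
  by apply/andP; split=> //; apply/forall_inP => T; apply: S1min.
have [S2 S2w S2max] := arg_maxP (P := min_weight p j) (payment p) S1w.
have /negP[] := negbT (noBR S2).
by apply/andP; split=> //; apply/forall_inP => T; apply: S2max.
Qed.

(* Main.v *)
(** Let [m] be the number of priceable edges, [p] an optimal price function and
    [S_j] the purchase of follower [j]. The optimal revenue is the sum over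
    priceable [e] of [p e * (total demand of the j with e \in S_j)]. At the
    common price [p e / m], such a follower can afford [S_j], which contains at
    most [m] priceable edges and so costs him at most
    [p e <= payment p S_j] for them. Thus he still buys something and pays at
    least [p e / m]. Hence each of the [m] terms of the sum is at most [m] times
    the revenue of some common price. Rounding that price down to a power of
    [1 + eps] loses no buyer and costs a factor [1 + eps]; a price below 1 is
    instead raised to 1, which loses no buyer by [unit_normalized]. *)
Require Import Defs.
From mathcomp Require Import all_boot all_order all_algebra.
From mathcomp Require Import reals exp.
Set Implicit Arguments.
Unset Strict Implicit.
Unset Printing Implicit Defensive.
Import Order.TTheory GRing.Theory Num.Theory.
Local Open Scope ring_scope.

Lemma response_feasible (R : realType) (G : pricing_game R) (p : prices G)
    (j : 'I_(followers G)) : response p j \in feasible j.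
Proof. by case/andP: (response_best p j) => /andP[]. Qed.

Lemma weight_response_le (R : realType) (G : pricing_game R) (p : prices G)
    (j : 'I_(followers G)) (T : {set edge G}) :
  T \in feasible j -> weight p (response p j) <= weight p T.
Proof.
by case/andP: (response_best p j) => /andP[_ /forall_inP minS] _; apply: minS.
Qed.

Lemma payment_fixed_only (R : realType) (G : pricing_game R) (p : prices G)
    (S : {set edge G}) : S :&: priceable G = set0 -> payment p S = 0.
Proof. by rewrite /payment => ->; rewrite big_set0. Qed.

Lemma fixed_cost_ge0 (R : realType) (G : pricing_game R) (S : {set edge G}) :
  0 <= fixed_cost S.
Proof.
by apply: sumr_ge0 => e; rewrite !inE => /andP[_]; apply: cost_ge0.
Qed.

Lemma payment_ge0 (R : realType) (G : pricing_game R) (p : prices G)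
    (S : {set edge G}) : admissible p -> 0 <= payment p S.
Proof.
by move=> p_ge0; apply: sumr_ge0 => e; rewrite inE => /andP[_]; apply: p_ge0.
Qed.

Lemma payment_uniform (R : realType) (G : pricing_game R) (q : R)
    (S : {set edge G}) :
  payment (uniform G q) S = q *+ #|S :&: priceable G|.
Proof. by rewrite /payment sumr_const. Qed.

Lemma revenue_ge0 (R : realType) (G : pricing_game R) (p : prices G) :
  admissible p -> 0 <= revenue p.
Proof.
move=> p_ge0; apply: sumr_ge0 => j _.
by rewrite mulr_ge0 ?demand_ge0 ?payment_ge0.
Qed.

(** The fixed-price alternative weighs the same under every [p], so [fixed_only_cost j] acts as the
    budget of follower [j] at all prices. *)
Lemma weight_response_le_fixed_only (R : realType) (G : pricing_game R)
    (p : prices G) (j : 'I_(followers G)) :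
  weight p (response p j) <= fixed_only_cost j.
Proof.
rewrite /fixed_only_cost; case: arg_minP => [|S /andP[Sf Sfix] _].
  exact: xchooseP (feasible_fixed j).
apply: le_trans (weight_response_le p Sf) _.
rewrite /weight payment_fixed_only ?addr0 //.
by apply/eqP; rewrite setI_eq0 disjoints_subset.
Qed.

Lemma fixed_only_cost_le (R : realType) (G : pricing_game R)
    (j : 'I_(followers G)) (S : {set edge G}) :
  S \in feasible j -> S :&: priceable G = set0 ->
  fixed_only_cost j <= fixed_cost S.
Proof.
move=> Sf /eqP; rewrite setI_eq0 disjoints_subset => Sfix.
rewrite /fixed_only_cost; case: arg_minP => [|T _ Tmin].
  exact: xchooseP (feasible_fixed j).
by apply: Tmin; rewrite Sf.
Qed.

(* Ties are broken in favour of revenue, so an affordable purchase is made even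
   when it is no cheaper than the fixed-price alternative. *)
Lemma buys_affordable (R : realType) (G : pricing_game R) (q : R)
    (j : 'I_(followers G)) (S : {set edge G}) :
  0 < q -> S \in feasible j -> S :&: priceable G != set0 ->
  weight (uniform G q) S <= fixed_only_cost j -> buys (uniform G q) j.
Proof.
move=> q_gt0 Sf SP wS; apply/negP => /eqP noP.
(* A response without priceable edges weighs at least [fixed_only_cost j], so [S] would also have
   minimum weight, and its positive payment would win the tie. *)
have wr : weight (uniform G q) S <=
    weight (uniform G q) (response (uniform G q) j).
  rewrite [leRHS]/weight payment_fixed_only // addr0.
  by apply: le_trans wS _; apply: fixed_only_cost_le noP;
    apply: response_feasible.
have minS : min_weight (uniform G q) j S.
  rewrite /min_weight Sf; apply/forall_inP => T Tf.
  by apply: le_trans wr _; apply: weight_response_le.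
case/andP: (response_best (uniform G q) j) => _ /forallP/(_ S)/implyP/(_ minS).
rewrite (payment_fixed_only _ noP) payment_uniform leNgt => /negP[].
by rewrite pmulrn_lgt0 // card_gt0.
Qed.

(** The set bought at [q] only gets cheaper at [q'], so it stays within the budget. *)
Lemma buys_uniform_le (R : realType) (G : pricing_game R) (q q' : R)
    (j : 'I_(followers G)) :
  0 < q' -> q' <= q -> buys (uniform G q) j -> buys (uniform G q') j.
Proof.
move=> q'_gt0 le_q'q bq.
apply: buys_affordable (response_feasible (uniform G q) j) bq _ => //.
apply: le_trans (weight_response_le_fixed_only (uniform G q) j).
by rewrite lerD2l !payment_uniform lerMn2r le_q'q orbT.
Qed.

Lemma payment_buys_ge (R : realType) (G : pricing_game R) (q : R)
    (j : 'I_(followers G)) :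
  0 <= q -> buys (uniform G q) j ->
  q <= payment (uniform G q) (response (uniform G q) j).
Proof.
move=> q_ge0 bq; rewrite payment_uniform -[leLHS]mulr1n.
by rewrite ler_wpMn2l // card_gt0.
Qed.

(** Justifies stopping the search at [last_exponent]: a buyer pays for at least one edge at price
    [q], within a bounded budget. *)
Lemma buys_le_max_fixed_only_cost (R : realType) (G : pricing_game R) (q : R)
    (j : 'I_(followers G)) :
  0 <= q -> buys (uniform G q) j -> q <= max_fixed_only_cost G.
Proof.
move=> q_ge0 bq; apply: le_trans (payment_buys_ge q_ge0 bq) _.
apply: (@le_trans _ _ (fixed_only_cost j)); last first.
  exact: (le_bigmax _ (fun i : 'I_(followers G) => fixed_only_cost i)).
apply: le_trans (weight_response_le_fixed_only (uniform G q) j).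
by rewrite lerDr fixed_cost_ge0.
Qed.

Lemma revenue_uniform_ge (R : realType) (G : pricing_game R) (q : R)
    (B : pred 'I_(followers G)) :
  0 <= q -> (forall j, B j -> buys (uniform G q) j) ->
  q * (\sum_(j | B j) demand j) <= revenue (uniform G q).
Proof.
move=> q_ge0 Bq; rewrite mulr_sumr /revenue [leRHS](bigID B) /=.
rewrite -[leLHS]addr0 lerD //.
  apply: ler_sum => j Bj; rewrite mulrC ler_wpM2l ?demand_ge0 //.
  exact: payment_buys_ge (Bq _ Bj).
apply: sumr_ge0 => j _; rewrite mulr_ge0 ?demand_ge0 //.
exact: payment_ge0.
Qed.

Lemma revenue_single_price_ge (R : realType) (G : pricing_game R) (eps : R)
    (i : nat) :
  (i <= last_exponent G eps)%N ->
  revenue (uniform G ((1 + eps) ^+ i)) <= revenue (single_price G eps).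
Proof.
move=> le_i; rewrite /single_price; case: arg_maxP => // k _ kmax.
exact: (kmax (Ordinal (le_i : (i < (last_exponent G eps).+1)%N))).
Qed.

Lemma revenue_single_price_ge0 (R : realType) (G : pricing_game R) (eps : R) :
  0 < eps -> 0 <= revenue (single_price G eps).
Proof.
move=> eps_gt0; apply: revenue_ge0 => e _.
by rewrite /single_price /uniform exprn_ge0 // addr_ge0 ?ltW.
Qed.

Lemma truncn_log_itv (R : realType) (eps q : R) :
  0 < eps -> 1 <= q ->
  (1 + eps) ^+ Num.truncn (ln q / ln (1 + eps)) <= q
    < (1 + eps) ^+ (Num.truncn (ln q / ln (1 + eps))).+1.
Proof.
move=> eps_gt0 q_ge1.
have q_gt0 : 0 < q by apply: lt_le_trans q_ge1.
have b_gt0 : 0 < 1 + eps by rewrite addr_gt0.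
have lnb_gt0 : 0 < ln (1 + eps) by rewrite ln_gt0 // ltrDl.
have /truncn_itv/andP[lo hi] : 0 <= ln q / ln (1 + eps).
  by apply: divr_ge0; [apply: ln_ge0 | apply: ltW].
apply/andP; split.
  rewrite -ler_ln ?posrE ?exprn_gt0 // lnXn //.
  by rewrite -[leLHS]mulr_natl -ler_pdivlMr.
rewrite -ltr_ln ?posrE ?exprn_gt0 // lnXn //.
by rewrite -[ltRHS]mulr_natl -ltr_pdivrMr.
Qed.

(** [B] need not contain all buyers at [q]; it will be the set of followers who buy one given edge
    under the optimal prices. *)
Lemma single_price_approx (R : realType) (G : pricing_game R) (eps q : R)
    (B : pred 'I_(followers G)) :
  0 < eps -> unit_normalized G -> 0 < q ->
  (forall j, B j -> buys (uniform G q) j) ->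
  q * (\sum_(j | B j) demand j) <= (1 + eps) * revenue (single_price G eps).
Proof.
move=> eps_gt0 hunit q_gt0 Bq.
have b_gt0 : 0 < 1 + eps by rewrite addr_gt0.
have d_ge0 : 0 <= \sum_(j | B j) demand j.
  by apply: sumr_ge0 => j _; apply: demand_ge0.
have r_ge0 := revenue_single_price_ge0 G eps_gt0.
have [q_le1|/ltW q_ge1] := leP q 1.
  apply: (@le_trans _ _ (revenue (single_price G eps))); last first.
    by rewrite ler_peMl // lerDl ltW.
  apply: le_trans _ (revenue_single_price_ge (leq0n _)).
  rewrite expr0; apply: (@le_trans _ _ (1 * \sum_(j | B j) demand j)).
    by rewrite ler_wpM2r.
  by apply: revenue_uniform_ge => // j /Bq; apply: hunit.
(* A buyer at [q] is what bounds [q], hence the exponent, by the search range; if [B] is empty, the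
   demand sum is 0. *)
case: (pickP B) => [j0 Bj0|B0]; last first.
  by rewrite big_pred0 // mulr0 mulr_ge0 // ltW.
set i := Num.truncn (ln q / ln (1 + eps)).
have /andP[lo hi] := truncn_log_itv eps_gt0 q_ge1.
have le_i : (i <= last_exponent G eps)%N.
  have le_q := buys_le_max_fixed_only_cost (ltW q_gt0) (Bq _ Bj0).
  apply: le_truncn; rewrite ler_pM2r ?invr_gt0 ?ln_gt0 ?ltrDl //.
  by rewrite ler_ln ?posrE // (lt_le_trans q_gt0 le_q).
(* The power [i.+1] exceeds [q]; its surplus over the tried power [i] is the factor [1 + eps] of the
   bound. *)
apply: (@le_trans _ _ ((1 + eps) ^+ i.+1 * \sum_(j | B j) demand j)).
  by rewrite ler_wpM2r // ltW.
rewrite exprS -mulrA ler_pM2l //.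
apply: le_trans _ (revenue_single_price_ge le_i).
apply: revenue_uniform_ge => [|j /Bq]; first by rewrite exprn_ge0 // ltW.
by apply: buys_uniform_le => //; rewrite exprn_gt0.
Qed.

(** Exchanging the sums over followers and edges lets each edge be bounded separately. *)
Lemma revenue_edge_sum (R : realType) (G : pricing_game R) (p : prices G) :
  revenue p = \sum_(e in priceable G)
    p e * (\sum_(j | e \in response p j) demand j).
Proof.
under [RHS]eq_bigr do rewrite mulr_sumr.
rewrite (exchange_big_dep predT) //=; apply: eq_bigr => j _.
rewrite /payment mulr_sumr; apply: eq_big => [e|e _];
  first by rewrite inE andbC.
by rewrite mulrC.
Qed.

Lemma buys_average_price (R : realType) (G : pricing_game R) (p : prices G)
    (j : 'I_(followers G)) (e : edge G) :
  admissible p -> e \in priceable G -> 0 < p e -> e \in response p j ->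
  buys (uniform G (p e / #|priceable G|%:R)) j.
Proof.
move=> p_ge0 eP pe_gt0 eS; set S := response p j in eS *.
have m_gt0 : (0 : R) < #|priceable G|%:R.
  by rewrite ltr0n card_gt0; apply/set0Pn; exists e.
have eSP : e \in S :&: priceable G by rewrite inE eS.
apply: (@buys_affordable _ _ _ _ S).
- by rewrite divr_gt0.
- exact: response_feasible.
- by apply/set0Pn; exists e.
apply: le_trans (weight_response_le_fixed_only p j); rewrite lerD2l.
apply: (@le_trans _ _ (p e)).
  rewrite payment_uniform -[leLHS]mulr_natr mulrAC ler_pdivrMr // ler_pM2l //.
  by rewrite ler_nat subset_leq_card // subsetIr.
rewrite /payment (bigD1 e) //= lerDl; apply: sumr_ge0 => f.
by rewrite inE => /andP[/andP[_ fP] _]; apply: p_ge0.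
Qed.

Theorem theorem3p2 (R : realType) (G : pricing_game R) (eps rstar : R)
    (heps : 0 < eps)
    (hunit : unit_normalized G)
    (hrstar : is_max_revenue G rstar) :
  rstar <=
    (1 + eps) * (#|priceable G|%:R) ^+ 2 * revenue (single_price G eps).
Proof.
case: hrstar => [[p p_ge0 <-] _]; rewrite revenue_edge_sum.
set m : R := #|priceable G|%:R; set r := revenue _.
have r_ge0 : 0 <= r := revenue_single_price_ge0 G heps.
(* One factor [m] counts the edges summed over; the other undoes the division in the price
   [p e / m]. *)
have -> : (1 + eps) * m ^+ 2 * r =
    \sum_(e in priceable G) m * ((1 + eps) * r).
  by rewrite sumr_const -[RHS]mulr_natl -/m expr2 [RHS]mulrA -mulrA mulrCA.
apply: ler_sum => e eP.
have m_gt0 : 0 < m by rewrite ltr0n card_gt0; apply/set0Pn; exists e.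
(* An edge of price 0 yields no positive common price, but it contributes nothing to the sum. *)
have [pe_gt0|pe_le0] := ltP 0 (p e); last first.
  have -> : p e = 0 by apply: le_anti; rewrite pe_le0 p_ge0.
  by rewrite mul0r mulr_ge0 ?(ltW m_gt0) ?mulr_ge0 ?addr_ge0 ?(ltW heps).
rewrite -ler_pdivrMl // mulrA [m^-1 * _]mulrC.
apply: single_price_approx => // [|j]; first by rewrite divr_gt0.
exact: buys_average_price.
Qed.
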